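(* Let $A$ be a nonempty finite set of positive integers, let $n\in\mathbb{N}$ and $d,e\in\mathbb{N}\cup\{\infty\}$. Then: 1. If $d\ge U_1(n)$ and $e<U_2(n)$, then $W(n;d,e)=1$. 2. If $d<U_1(n)$ and $e\ge U_2(n)$, then $W(n;d,e)=2$. 3. If $d\ge U_1(n)$ and $e\ge U_2(n)$, then $W(n;d,e)=W(n)$.
   Context: $\mathbb{N}=\{0,1,2,\dots\}$. In the game $\mathrm{NIM}(A;n)$ two players alternate (Player 1 first) removing some $a\in A$ stones from a pile of $n$ stones ($a$ may not exceed the number of stones left); a player who cannot move loses. $W(n)\in\{1,2\}$ is the player with a winning strategy. In the NIM with Cash game $\mathrm{NIM}(A;n;d,e)$, Player 1 starts with $d$ dollars and Player 2 with $e$ dollars ($\infty$ means unlimited money). Players alternate, Player 1 first; a move consists of removing some $a\in A$ stones and paying $a$ dollars, where $a$ may exceed neither the number of stones left nor the mover's money. A player who cannot move on his turn loses. $W(n;d,e)\in\{1,2\}$ is the player with a winning strategy. The upper class amounts $U_1(n),U_2(n)\in\mathbb{N}$ are defined recursively (depending on $A$): - If $n<\min(A)$, then $U_1(n)=U_2(n)=0$. - If $n\ge\min(A)$ and $W(n)=1$, then $U_1(n)=\min\{U_2(n-a)+a : a\in A,\ a\le n,\ W(n-a)=2\}$ and $U_2(n)=\max\{U_1(n-a): a\in A,\ a\le n\}$. - If $n\ge\min(A)$ and $W(n)=2$, then $U_2(n)=\max\{U_1(n-a): a\in A,\ a\le n\}$ and $U_1(n)=\min\{U_2(n-a)+a :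 a\in A,\ a\le n,\ U_1(n-a)=U_2(n)\}$. *)

(* Defs.v *)
From HB Require Import structures.
From mathcomp Require Import all_boot finmap.

Set Implicit Arguments.
Unset Strict Implicit.
Unset Printing Implicit Defensive.

(** * Two-player games under normal play *)

Variant player := Player1 | Player2.

Definition other (p : player) : player :=
  if p is Player1 then Player2 else Player1.

Definition player_eqb (p q : player) : bool :=
  match p, q with
  | Player1, Player1 | Player2, Player2 => true
  | _, _ => false
  end.

Lemma player_eqP : Equality.axiom player_eqb.
Proof. by do 2!case; constructor. Qed.

HB.instance Definition _ := hasDecEq.Build player player_eqP.

(* [options p x] lists the positions that [p] may move to from [x] on his turn;
   [rank] witnesses that every play is finite. *)
Record game := Game {
  position : eqType;
  start : position;
  options : player -> position -> seq position;
  rank : position -> nat;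
  rank_options :
    forall p x y, y \in options p x -> rank y < rank x }.

(* A history is the sequence of the positions reached so far, without the
   starting position. *)
Definition mover (T : Type) (h : seq T) : player :=
  if odd (size h) then Player2 else Player1.

Definition current (G : game) (h : seq (position G)) : position G :=
  last (start G) h.

Definition strategy (G : game) := seq (position G) -> position G.

Inductive play_with (G : game) (p : player) (s : strategy G) :
  seq (position G) -> Prop :=
| play_start : play_with p s [::]
| play_move h y :
    play_with p s h ->
    y \in options (mover h) (current h) ->
    (mover h = p -> y = s h) ->
    play_with p s (rcons h y).

(* The strategy never prescribes an illegal move, and whenever a play
   consistent with it is over, the player who cannot move is the opponent. *)
Definition winning_strategy (G : game) (p : player) (s : strategy G) : Prop :=
  (forall h, play_with p s h -> mover h = p ->
     options p (current h) != [::] -> s h \in options p (current h)) /\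
  (forall h, play_with p s h ->
     options (mover h) (current h) = [::] -> mover h <> p).

Definition has_winning_strategy (G : game) (p : player) : Prop :=
  exists s : strategy G, winning_strategy p s.

(** ** Determinacy, by backward induction *)

Fixpoint mover_wins_rec (G : game) (k : nat) (p : player) (x : position G) :
  bool :=
  if k is k'.+1
  then has (fun y => ~~ mover_wins_rec k' (other p) y) (options p x)
  else false.

Definition mover_wins (G : game) (p : player) (x : position G) : bool :=
  mover_wins_rec (rank x) p x.

Lemma mover_wins_recE (G : game) k p (x : position G) :
  rank x <= k -> mover_wins_rec k p x = mover_wins p x.
Proof.
rewrite /mover_wins => le_xk.
suff: forall i j p (x : position G), rank x <= i -> rank x <= j ->
  mover_wins_rec i p x = mover_wins_rec j p x by apply.
move=> {k p x le_xk}.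
have opt0 p (x : position G) : rank x <= 0 -> options p x = [::].
  move=> le_x0; case Eo: (options p x) => [|y o] //.
  have /rank_options/leq_trans/(_ le_x0) : y \in options p x.
    by rewrite Eo mem_head.
  by [].
elim=> [|i IH] [|j] p x //= le_xi le_xj; try by rewrite opt0.
apply: eq_in_has => y /rank_options lt_yx.
by rewrite (IH j) // -ltnS (leq_trans lt_yx).
Qed.

Lemma mover_winsE (G : game) p (x : position G) :
  mover_wins p x = has (fun y => ~~ mover_wins (other p) y) (options p x).
Proof.
rewrite -(mover_wins_recE p (leqnSn (rank x))) /=.
apply: eq_in_has => y /rank_options ltyx.
by rewrite mover_wins_recE // ltnW.
Qed.

Lemma mover_rcons (T : Type) (h : seq T) y :
  mover (rcons h y) = other (mover h).
Proof. by rewrite /mover size_rcons /=; case: odd. Qed.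

Lemma current_rcons (G : game) h (y : position G) : current (rcons h y) = y.
Proof. by rewrite /current last_rcons. Qed.

Lemma backward_induction (G : game) (p : player) :
  mover_wins Player1 (start G) = (p == Player1) -> has_winning_strategy G p.
Proof.
move=> start_p.
pose good q (y : position G) := ~~ mover_wins (other q) y.
pose s : strategy G := fun h =>
  nth (current h) (options p (current h))
      (find (good p) (options p (current h))).
have inv h : play_with p s h -> mover_wins (mover h) (current h) = (mover h == p).
  elim=> [|{}h y _ IH y_opt y_s]; first by rewrite start_p eq_sym.
  rewrite mover_rcons current_rcons.
  have [Ep|Np] := eqVneq (mover h) p.
    move: IH; rewrite y_s // Ep eqxx mover_winsE => hasg.
    have := nth_find (current h) hasg => /negbTE ->.
    by case: (p).
  move: IH; rewrite (negbTE Np) mover_winsE => /negbT/hasPn/(_ _ y_opt).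
  by rewrite negbK => ->; move: Np; case: (mover h); case: (p).
exists s; split=> h h_play.
  move=> Ep _; have := inv h h_play; rewrite Ep eqxx mover_winsE => hasg.
  by rewrite mem_nth // -has_find.
by move=> no_opt Ep; have := inv h h_play; rewrite mover_winsE no_opt Ep eqxx.
Qed.

Lemma determined (G : game) : {p : player | has_winning_strategy G p}.
Proof.
case E: (mover_wins Player1 (start G)).
- by exists Player1; apply: backward_induction.
- by exists Player2; apply: backward_induction.
Qed.

Definition winner (G : game) : player := sval (determined G).

Lemma winnerP (G : game) : has_winning_strategy G (winner G).
Proof. exact: svalP (determined G). Qed.

Lemma has_winning_strategy_inj (G : game) (p q : player) :
  has_winning_strategy G p -> has_winning_strategy G q -> p = q.
Proof.
move=> [s [s_legal s_win]] [t [t_legal t_win]].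
have [//|npq] := eqVneq p q.
have mover_pq (h : seq (position G)) : mover h = p \/ mover h = q.
  by move: npq; case: (mover h); case: (p); case: (q); auto.
suff no_play k (h : seq (position G)) : rank (current h) < k ->
    play_with p s h -> play_with q t h -> False.
  by case: (no_play (rank (start G)).+1 [::] (leqnn _)); apply: play_start.
elim: k h => [//|k IH] h lt_k hs ht.
have optN0 : options (mover h) (current h) != [::].
  apply/eqP=> opt0; have := t_win h ht opt0; have := s_win h hs opt0.
  by case: (mover_pq h).
have [y [y_opt y_s y_t]] : exists y,
    [/\ y \in options (mover h) (current h),
        mover h = p -> y = s h & mover h = q -> y = t h].
  case: (mover_pq h) => E.
  - exists (s h); split=> //; last by move: npq; rewrite -E => /eqP.
    by rewrite E; apply: s_legal; rewrite // -E.
  - exists (t h); split=> //; last by move: npq; rewrite -E eq_sym => /eqP.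
    by rewrite E; apply: t_legal; rewrite // -E.
apply: (IH (rcons h y)); try exact: play_move.
by rewrite current_rcons -ltnS (leq_ltn_trans (rank_options y_opt)).
Qed.

Lemma winner_uniq (G : game) (p : player) :
  has_winning_strategy G p -> winner G = p.
Proof. exact: has_winning_strategy_inj (winnerP G). Qed.

Lemma winnerE (G : game) :
  winner G = if mover_wins Player1 (start G) then Player1 else Player2.
Proof. by apply/winner_uniq/backward_induction; case: mover_wins. Qed.

(** * NIM and NIM with Cash *)

Record move_set := MoveSet {
  moves :> {fset nat};
  moves_neq0 : moves != fset0;
  moves_pos : forall a : nat, a \in moves -> 0 < a }.

Definition nim_options (A : move_set) (_ : player) (n : nat) : seq nat :=
  [seq n - a | a <- A & a <= n].

Lemma sub_move_lt (A : move_set) (n a : nat) :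
  a \in moves A -> a <= n -> n - a < n.
Proof.
by move=> /moves_pos a_gt0 le_an; rewrite ltn_subrL a_gt0 (leq_trans a_gt0).
Qed.

Lemma nim_rank (A : move_set) p n m : m \in nim_options A p n -> m < n.
Proof.
case/mapP=> a; rewrite mem_filter => /andP[le_an /moves_pos a_gt0] ->.
by rewrite ltn_subrL a_gt0 (leq_trans a_gt0).
Qed.

Definition nim (A : move_set) (n : nat) : game :=
  Game n (@nim_rank A).

Definition W (A : move_set) (n : nat) : player := winner (nim A n).

(* [None] is an unlimited amount of money. *)
Notation cash := (option nat).

Definition cash_ge (c : cash) (m : nat) : bool :=
  if c is Some k then m <= k else true.

Definition cash_lt (c : cash) (m : nat) : bool :=
  if c is Some k then k < m else false.

Definition pay (c : cash) (m : nat) : cash :=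
  if c is Some k then Some (k - m) else None.

(* A position is (stones left, money of Player 1, money of Player 2). *)
Definition nim_cash_options (A : move_set) (p : player)
    (x : nat * cash * cash) : seq (nat * cash * cash) :=
  let: (n, d, e) := x in
  match p with
  | Player1 =>
      [seq (n - a, pay d a, e) | a <- A & (a <= n) && cash_ge d a]
  | Player2 =>
      [seq (n - a, d, pay e a) | a <- A & (a <= n) && cash_ge e a]
  end.

Lemma nim_cash_rank (A : move_set) p x y :
  y \in nim_cash_options A p x -> y.1.1 < x.1.1.
Proof.
case: x => [[n d] e]; case: p => /= /mapP[a];
  rewrite mem_filter -andbA => /and3P[le_an _ /moves_pos a_gt0] -> /=;
  by rewrite ltn_subrL a_gt0 (leq_trans a_gt0).
Qed.

Definition nim_cash (A : move_set) (n : nat) (d e : cash) : game :=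
  Game (n, d, e) (@nim_cash_rank A).

Definition Wcash (A : move_set) (n : nat) (d e : cash) : player :=
  winner (nim_cash A n d e).

(** * Upper class amounts *)

(* 0 on the empty sequence; the minima taken below are over nonempty sets. *)
Definition seqmin (s : seq nat) : nat := \big[minn/head 0 s]_(a <- s) a.

Lemma seqminP (s : seq nat) m :
  s != [::] -> (m <= seqmin s) = all (fun a => m <= a) s.
Proof.
case: s => // a s _; rewrite /seqmin /= big_cons leq_min.
case: (leqP m a) => //= le_ma.
by elim: s => [|b s IH]; rewrite ?big_nil // big_cons leq_min IH.
Qed.

Lemma seqmin_mem (s : seq nat) : s != [::] -> seqmin s \in s.
Proof.
move=> s0; apply: contraT => notin.
have : seqmin s < seqmin s.
  rewrite seqminP //; apply/allP => a a_s.
  rewrite ltn_neqAle (contraNneq _ notin) => [|->//] /=.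
  by move: a a_s; apply/allP; rewrite -seqminP.
by rewrite ltnn.
Qed.

Lemma eq_in_map_filter (s : seq nat) (P Q : pred nat) (f g : nat -> nat) :
  {in s, P =1 Q} -> {in s, forall a, Q a -> f a = g a} ->
  [seq f a | a <- s & P a] = [seq g a | a <- s & Q a].
Proof.
move=> /eq_in_filter-> fg; apply/eq_in_map => a.
by rewrite mem_filter => /andP[Qa /fg->].
Qed.

(* The pair (U_1(n), U_2(n)) as soon as n < k, see [U_recE]. *)
Fixpoint U_rec (A : move_set) (k n : nat) : nat * nat :=
  if k is k'.+1 then
    let u1 m := (U_rec A k' m).1 in
    let u2 m := (U_rec A k' m).2 in
    if n < seqmin A then (0, 0) else
    let v2 := \max_(a <- A | a <= n) u1 (n - a) in
    let v1 := match W A n with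
      | Player1 =>
          seqmin [seq u2 (n - a) + a
                 | a <- A & (a <= n) && (W A (n - a) == Player2)]
      | Player2 =>
          seqmin [seq u2 (n - a) + a
                 | a <- A & (a <= n) && (u1 (n - a) == v2)]
      end in
    (v1, v2)
  else (0, 0).

Definition U1 (A : move_set) (n : nat) : nat := (U_rec A n.+1 n).1.
Definition U2 (A : move_set) (n : nat) : nat := (U_rec A n.+1 n).2.

Lemma U_recE (A : move_set) k n : n < k -> U_rec A k n = (U1 A n, U2 A n).
Proof.
rewrite /U1 /U2 -surjective_pairing.
have [m] := ubnP k; elim: m => // m IH in k n *.
case: k => // k ltkm ltnk.
have Urec a : a \in moves A -> a <= n -> U_rec A k (n - a) = U_rec A n (n - a).
  move=> /moves_pos a_gt0 le_an.
  have lt_n : n - a < n by rewrite ltn_subrL a_gt0 (leq_trans a_gt0).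
  rewrite (IH k) // ?(leq_trans lt_n) //; symmetry; apply: IH => //.
  exact: leq_ltn_trans ltnk ltkm.
rewrite /=; case: ltnP => // _.
have -> : \max_(a <- A | a <= n) (U_rec A k (n - a)).1 =
          \max_(a <- A | a <= n) (U_rec A n (n - a)).1.
  rewrite big_seq_cond [RHS]big_seq_cond.
  by apply: eq_bigr => a /andP[aA le_an]; rewrite Urec.
congr (_, _); case: (W A n); congr seqmin.
  by apply: eq_in_map_filter => // a aA /andP[le_an _]; rewrite Urec.
apply: eq_in_map_filter => a aA; last by case/andP=> le_an _; rewrite Urec.
by case: leqP => //= le_an; rewrite Urec.
Qed.

Lemma U_small (A : move_set) n : n < seqmin A -> U1 A n = 0 /\ U2 A n = 0.
Proof. by rewrite /U1 /U2 /= => ->. Qed.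

Lemma U2E (A : move_set) n :
  seqmin A <= n -> U2 A n = \max_(a <- A | a <= n) U1 A (n - a).
Proof.
move=> le_n; rewrite {1}/U2 /= ltnNge le_n /= big_seq_cond [RHS]big_seq_cond.
apply: eq_bigr => a /andP[aA le_an].
by rewrite U_recE // (sub_move_lt aA).
Qed.

Lemma U1E_win (A : move_set) n :
  seqmin A <= n -> W A n = Player1 ->
  U1 A n = seqmin [seq U2 A (n - a) + a
                  | a <- A & (a <= n) && (W A (n - a) == Player2)].
Proof.
move=> le_n Wn; rewrite {1}/U1 /= ltnNge le_n /= Wn; congr seqmin.
apply/eq_in_map => a; rewrite mem_filter => /andP[/andP[le_an _] aA].
by rewrite U_recE // (sub_move_lt aA).
Qed.

Lemma U1E_lose (A : move_set) n :
  seqmin A <= n -> W A n = Player2 ->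
  U1 A n = seqmin [seq U2 A (n - a) + a
                  | a <- A & (a <= n) && (U1 A (n - a) == U2 A n)].
Proof.
move=> le_n Wn; rewrite {1}/U1 [U_rec _ _ _]/= ltnNge le_n [LHS]/= Wn.
have Urec a : a \in moves A -> a <= n ->
    U_rec A n (n - a) = (U1 A (n - a), U2 A (n - a)).
  by move=> aA le_an; rewrite U_recE // (sub_move_lt aA).
have -> : \max_(a <- A | a <= n) (U_rec A n (n - a)).1 = U2 A n.
  by rewrite /U2 /= ltnNge le_n.
congr seqmin; apply: eq_in_map_filter => a aA.
  by case: leqP => //= le_an; rewrite Urec.
by case/andP=> le_an _; rewrite Urec.
Qed.

(* Main.v *)
Require Import Defs.
From mathcomp Require Import all_boot finmap.

Set Implicit Arguments.
Unset Strict Implicit.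
Unset Printing Implicit Defensive.

(** Induction on the pile [n], seen from the player to move, whose fortune is
    [d], against an opponent with fortune [e]; a move [a] exchanges the roles and
    leads to [(n - a; e, d - a)]. If the mover wins at [n], the minimum defining
    [U1 n] is attained by a move to a position lost in plain NIM which stays
    affordable. If he loses at [n] but [e < U2 n], he plays a move maximizing
    [U1 (n - a)], after which the opponent is too poor. Conversely, an opponent
    with [e >= U2 n] can afford [U1 (n - a)] after every move [a]. *)

(** If every value were below the maximum [M], then [M.-1] would already bound them all; [x]
    excludes the empty maximum, which is 0. *)
Lemma bigmax_attained (T : eqType) (s : seq T) (P : pred T) (F : T -> nat) x :
  x \in s -> P x ->
  exists y, [/\ y \in s, P y & F y = \max_(i <- s | P i) F i].
Proof.
move=> x_s Px; set M := \max_(i <- s | P i) F i.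
case: (boolP (has (fun y => P y && (F y == M)) s)).
  by case/hasP=> y y_s /andP[Py /eqP FyM]; exists y.
move=> /hasPn notM.
have ltM y : y \in s -> P y -> F y < M.
  move=> y_s Py; rewrite ltn_neqAle leq_bigmax_seq // andbT.
  by have := notM y y_s; rewrite Py.
have M_gt0 : 0 < M by apply: leq_ltn_trans (ltM x x_s Px).
have : M <= M.-1.
  by apply/bigmax_leqP_seq=> y y_s Py; rewrite -ltnS prednK ?ltM.
by rewrite leqNgt ltn_predL M_gt0.
Qed.

(* [nim A n] and [nim A (n - a)] are games differing only in their start, and
   likewise for [nim_cash]. *)
Definition restart (G : game) (x : position G) : game :=
  Game x (@rank_options G).

Lemma mover_wins_restart (G : game) (x : position G) p (y : position G) :
  mover_wins (G := restart x) p y = mover_wins p y.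
Proof.
rewrite /mover_wins; change (@rank (restart x)) with (@rank G).
move: (rank y) => k; elim: k p y => // k IH p y.
by apply: eq_has => z; congr (~~ _); apply: IH.
Qed.

Lemma winner_eq1 (G : game) :
  (winner G == Player1) = mover_wins Player1 (start G).
Proof. by rewrite winnerE; case: mover_wins. Qed.

Lemma player_neq1 (p : player) : (p != Player1) = (p == Player2).
Proof. by case: p. Qed.

Lemma mover_wins_nim_sym (A : move_set) (m n : nat) :
  mover_wins (G := nim A m) Player2 n = mover_wins (G := nim A m) Player1 n.
Proof.
elim/ltn_ind: n => n IH; rewrite !mover_winsE.
by apply: eq_in_has => y /(@nim_rank A Player2)/IH /= ->.
Qed.

(** After the first move Player 2 is to move; since NIM is impartial, what remains is a fresh game
    on [n - a] with the roles renamed. *)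
Lemma W_eq1 (A : move_set) (n : nat) :
  (W A n == Player1) =
  has (fun a => (a <= n) && (W A (n - a) == Player2)) (moves A).
Proof.
rewrite /W winner_eq1 mover_winsE has_map has_filter.
rewrite -filter_predI -has_filter; apply: eq_has => a /=.
rewrite -player_neq1 winner_eq1 andbC; congr (_ && ~~ _).
by rewrite mover_wins_nim_sym -(mover_wins_restart (G := nim A n) (n - a)).
Qed.

(** Only the fortunes tell the players apart, so renaming the players amounts to swapping [d] and
    [e]. *)
Lemma mover_wins_cash_sym (A : move_set) m c c' (n : nat) (d e : cash) :
  mover_wins (G := nim_cash A m c c') Player2 (n, d, e) =
  mover_wins (G := nim_cash A m c c') Player1 (n, e, d).
Proof.
elim/ltn_ind: n d e => n IH d e; rewrite !mover_winsE /= !has_map.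
apply: eq_in_has => a; rewrite mem_filter => /andP[/andP[le_an _] aA] /=.
by rewrite IH // (sub_move_lt aA).
Qed.

Lemma Wcash_eq1 (A : move_set) (n : nat) (d e : cash) :
  (Wcash A n d e == Player1) =
  has (fun a => [&& a <= n, cash_ge d a & Wcash A (n - a) e (pay d a) == Player2])
      (moves A).
Proof.
rewrite /Wcash winner_eq1 mover_winsE has_map has_filter.
rewrite -filter_predI -has_filter; apply: eq_has => a /=.
rewrite -player_neq1 winner_eq1 andbC andbA; congr (_ && ~~ _).
rewrite mover_wins_cash_sym.
by rewrite -(mover_wins_restart (G := nim_cash A n d e) (n - a, e, pay d a)).
Qed.

Lemma cash_ltNge (c : cash) (m : nat) : cash_lt c m = ~~ cash_ge c m.
Proof. by case: c => //= k; rewrite ltnNge. Qed.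

Lemma cash_ge_trans (c : cash) (m k : nat) :
  k <= m -> cash_ge c m -> cash_ge c k.
Proof. by case: c => //= j; apply: leq_trans. Qed.

(** The payment must be affordable: [pay] truncates at 0, which would falsify the case [m = 0]. *)
Lemma cash_ge_pay (c : cash) (a m : nat) :
  cash_ge c a -> cash_ge (pay c a) m = cash_ge c (m + a).
Proof. by case: c => //= k le_ak; rewrite leq_subRL // addnC. Qed.

Lemma seqmin_le (s : seq nat) (x : nat) : x \in s -> seqmin s <= x.
Proof.
move=> x_s; have s0 : s != [::] by apply: contraTneq x_s => ->.
by have := leqnn (seqmin s); rewrite {1}seqminP // => /allP; apply.
Qed.

Lemma seqmin_moves_le (A : move_set) (a n : nat) :
  a \in moves A -> a <= n -> seqmin A <= n.
Proof. by move=> aA; apply: leq_trans; apply: seqmin_le. Qed.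

Lemma seqmin_moves_mem (A : move_set) : seqmin A \in moves A.
Proof.
have /fset0Pn[a aA] := moves_neq0 A.
by apply: seqmin_mem; apply: contraTneq (aA : a \in (moves A : seq nat)) => ->.
Qed.

Lemma seqmin_map_attained (T : eqType) (s : seq T) (P : pred T) (F : T -> nat) x :
  x \in s -> P x ->
  exists2 y, y \in s /\ P y & F y = seqmin [seq F i | i <- s & P i].
Proof.
move=> x_s Px.
have /seqmin_mem/mapP[y] : [seq F i | i <- s & P i] != [::].
  by rewrite -size_eq0 size_map size_eq0 -has_filter; apply/hasP; exists x.
by rewrite mem_filter => /andP[Py y_s] ->; exists y.
Qed.

Lemma seqmin_map_filter_le (T : eqType) (s : seq T) (P : pred T) (F : T -> nat) x :
  x \in s -> P x -> seqmin [seq F i | i <- s & P i] <= F x.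
Proof. by move=> x_s Px; rewrite seqmin_le // map_f // mem_filter Px. Qed.

Lemma U1_le_U2 (A : move_set) (n a : nat) :
  a \in moves A -> a <= n -> U1 A (n - a) <= U2 A n.
Proof.
move=> aA le_an; rewrite U2E ?(seqmin_moves_le aA) //.
exact: (@leq_bigmax_seq _ _ (fun a => a <= n) (fun a => U1 A (n - a))).
Qed.

Lemma U1_win_attained (A : move_set) (n : nat) :
  W A n = Player1 ->
  exists a, [/\ a \in moves A, a <= n, W A (n - a) = Player2 &
                U2 A (n - a) + a = U1 A n].
Proof.
move=> Wn; have /eqP := Wn; rewrite W_eq1 => /hasP[b bA Pb].
have le_n : seqmin A <= n by case/andP: Pb => /(seqmin_moves_le bA).
have [a [aA /andP[le_an /eqP Wa]] E] :=
  seqmin_map_attained (P := fun a => (a <= n) && (W A (n - a) == Player2))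
    (fun a => U2 A (n - a) + a) bA Pb.
by exists a; split=> //; rewrite U1E_win.
Qed.

Lemma U1_win_le (A : move_set) (n a : nat) :
  W A n = Player1 -> a \in moves A -> a <= n -> W A (n - a) = Player2 ->
  U1 A n <= U2 A (n - a) + a.
Proof.
move=> Wn aA le_an Wa; rewrite U1E_win ?(seqmin_moves_le aA) //.
apply: (@seqmin_map_filter_le _ _ _ (fun a => U2 A (n - a) + a)) => //.
by rewrite le_an Wa.
Qed.

Lemma U1_lose_attained (A : move_set) (n : nat) :
  seqmin A <= n -> W A n = Player2 ->
  exists a, [/\ a \in moves A, a <= n, U1 A (n - a) = U2 A n &
                U2 A (n - a) + a = U1 A n].
Proof.
move=> le_n Wn.
(* A move [b] attaining the maximum [U2 A n] shows that the set minimized in [U1 A n] is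
   nonempty. *)
have [b [bA le_bn Eb]] :=
  bigmax_attained (P := fun a => a <= n) (fun a => U1 A (n - a))
    (seqmin_moves_mem A) le_n.
have Pb : (b <= n) && (U1 A (n - b) == U2 A n) by rewrite le_bn U2E // Eb /=.
have [a [aA /andP[le_an /eqP Ua]] E] :=
  seqmin_map_attained (P := fun a => (a <= n) && (U1 A (n - a) == U2 A n))
    (fun a => U2 A (n - a) + a) bA Pb.
by exists a; split=> //; rewrite U1E_lose.
Qed.

Theorem theorem6p1 (A : move_set) (n : nat) (d e : cash) :
  (cash_ge d (U1 A n) -> cash_lt e (U2 A n) -> Wcash A n d e = Player1) /\
  (cash_lt d (U1 A n) -> cash_ge e (U2 A n) -> Wcash A n d e = Player2) /\
  (cash_ge d (U1 A n) -> cash_ge e (U2 A n) -> Wcash A n d e = W A n).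
Proof.
elim/ltn_ind: n d e => n IH d e; rewrite !cash_ltNge.
(* After [a] the mover still has [U2 A (n - a)]. A poor opponent then loses by claim 2 at [n - a]; a
   rich one is left with plain NIM, by claim 3. *)
have win a : a \in moves A -> a <= n -> cash_ge d (U2 A (n - a) + a) ->
    (cash_ge e (U1 A (n - a)) -> W A (n - a) = Player2) ->
    Wcash A n d e = Player1.
  move=> aA le_an d_ge Wa; apply/eqP; rewrite Wcash_eq1; apply/hasP; exists a => //.
  have d_a : cash_ge d a by apply: cash_ge_trans d_ge; rewrite leq_addl.
  have [_ [lose same]] := IH _ (sub_move_lt aA le_an) e (pay d a).
  rewrite le_an d_a /=; rewrite cash_ge_pay // in lose same; apply/eqP.
  case: (boolP (cash_ge e (U1 A (n - a)))) => e_ge.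
    by rewrite same // Wa.
  by rewrite lose // cash_ltNge.
(* Dually, the opponent is rich after every move: he wins by claim 1 if the mover has become poor,
   and otherwise by claim 3. *)
have lose : cash_ge e (U2 A n) ->
    (forall a, a \in moves A -> a <= n -> cash_ge d (U2 A (n - a) + a) ->
       W A (n - a) = Player1) ->
    Wcash A n d e = Player2.
  move=> e_ge Wa; apply/eqP; rewrite -player_neq1 Wcash_eq1 -all_predC.
  apply/allP => a aA /=; apply/negP => /and3P[le_an d_a].
  have e_a : cash_ge e (U1 A (n - a)) by apply: cash_ge_trans e_ge; apply: U1_le_U2.
  have [winM [_ same]] := IH _ (sub_move_lt aA le_an) e (pay d a).
  rewrite cash_ltNge in winM; rewrite !cash_ge_pay // in winM same.
  case: (boolP (cash_ge d (U2 A (n - a) + a))) => d_ge.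
    by rewrite same // Wa.
  by rewrite winM.
case Wn: (W A n).
- have rich : cash_ge d (U1 A n) -> Wcash A n d e = Player1.
    have [a [aA le_an Wa <-]] := U1_win_attained Wn => d_ge.
    exact: win aA le_an d_ge _.
  split; [by move=> /rich|split; last by move=> /rich].
  move=> d_lt e_ge; apply: lose => // a aA le_an d_ge.
  (* If [n - a] were lost in NIM, its cost would be one of those minimized in [U1 A n], forcing [d]
     to reach [U1 A n]. *)
  apply/eqP; apply: contraNT d_lt; rewrite player_neq1 => /eqP Wa.
  exact: cash_ge_trans (U1_win_le Wn aA le_an Wa) d_ge.
- have poor : cash_ge e (U2 A n) -> Wcash A n d e = Player2.
    move=> /lose; apply=> a aA le_an _.
    have : W A n != Player1 by rewrite Wn.
    by rewrite W_eq1 => /hasPn/(_ a aA); rewrite le_an -player_neq1 negbK => /eqP.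
  split; last by split=> _ /poor.
  (* With no legal move [U2 A n] is 0, and no fortune lies below 0. *)
  case: (ltnP n (seqmin A)) => [/U_small[_ ->]|le_n]; first by case: (e).
  have [a [aA le_an Ua <-]] := U1_lose_attained le_n Wn => d_ge.
  (* Here [e] is below [U1 A (n - a)], so the rich-opponent case of [win] is vacuous. *)
  by rewrite -Ua => /negbTE e_lt; apply: win aA le_an d_ge _; rewrite e_lt.
Qed.
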